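(* Let $k\geq 4$ be an integer and let $G$ be a finite simple undirected graph with $g(G)=\chi(G)=k$, where $g(G)$ is the girth of $G$ and $\chi(G)$ is the chromatic number of $G$. Let $\beta:V(G)\rightarrow\{1,2,\ldots,t\}$ be any proper colouring of $G$ (for some positive integer $t$). Then $G$ contains an induced path on $k$ vertices whose vertices receive pairwise distinct colours under $\beta$.
   Context: A proper colouring $\beta$ of $G$ is a map from $V(G)$ to a set of colours such that $\beta(u)\neq\beta(v)$ for every edge $uv\in E(G)$; it need not use only $\chi(G)$ colours. The girth $g(G)$ is the length of a shortest cycle in $G$. A path is induced if it is an induced subgraph of $G$, i.e., no two non-consecutive vertices of the path are adjacent in $G$. A subgraph is called colourful if no two of its vertices have the same colour. *)

(* Defs.v *)
From mathcomp Require Import all_boot.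
Set Implicit Arguments. Unset Strict Implicit. Unset Printing Implicit Defensive.

Definition simple_graph (T : finType) (e : rel T) : Prop :=
  symmetric e /\ irreflexive e.

Definition proper_colouring (T : finType) (C : Type) (e : rel T) (c : T -> C) : Prop :=
  forall u v, e u v -> c u <> c v.

Definition colourable (T : finType) (e : rel T) (n : nat) : Prop :=
  exists c : T -> 'I_n, proper_colouring e c.

Definition is_chromatic_number (T : finType) (e : rel T) (k : nat) : Prop :=
  colourable e k /\ forall n, colourable e n -> k <= n.

Definition graph_cycle (T : finType) (e : rel T) (s : seq T) : Prop :=
  3 <= size s /\ uniq s /\ cycle e s.

Definition is_girth (T : finType) (e : rel T) (g : nat) : Prop :=
  (exists s, graph_cycle e s /\ size s = g) /\
  forall s, graph_cycle e s -> g <= size s.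

Definition induced_path (T : finType) (e : rel T) (p : seq T) : Prop :=
  uniq p /\
  forall (x0 : T) (i j : nat), i < size p -> j < size p ->
    e (nth x0 p i) (nth x0 p j) = (i.+1 == j) || (j.+1 == i).

Definition colourful (T : finType) (C : eqType) (c : T -> C) (p : seq T) : Prop :=
  uniq (map c p).

(* Main.v *)
(* Suppose no induced path on k vertices is colourful. By the girth, the only
   possible chord of a path on k vertices joins its ends, so the ends of every
   colourful path on k vertices are adjacent. Label the vertices greedily in
   order of their colours, so that a vertex labelled l has, for every i < l, a
   neighbour labelled i of smaller colour. The vertices labelled at least k - 3
   induce a bipartite graph, whence G has k - 1 colours, a contradiction.

   To see bipartiteness, take a shortest closed walk of odd length among these
   vertices, let x have the smallest colour on it, and let m, x, v, w, n, n2 be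
   consecutive. Extending pieces of the walk by label-decreasing paths leaving x,
   n and w produces many colourful paths on k vertices, and joining their ends
   shows that w has the colour of x again; otherwise m and n2 would be adjacent,
   which shortens the walk (k = 4), or there would be a 4-cycle (k > 4). So the
   smallest colour recurs at every second step, impossible for an odd length.

   Below, j stands for k - 4, b for the colouring and g for the labelling. *)
Require Import Defs.
From mathcomp Require Import all_boot.
From mathcomp Require Import zify.
Set Implicit Arguments. Unset Strict Implicit. Unset Printing Implicit Defensive.

(** * Distinct colours and the greedy labelling *)

Lemma uniq_cat_mid (A : eqType) (s1 s s2 : seq A) :
  uniq s -> uniq (s1 ++ s2) -> all (fun c => c \notin s) (s1 ++ s2) ->
  uniq (s1 ++ s ++ s2).
Proof.
move=> us u12 dis; rewrite uniq_catCA cat_uniq us u12 andbT /=.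
by rewrite -all_predC.
Qed.

(** Vertices of equal colour are never adjacent, so a whole colour class is labelled at once; the
    induction runs over the colours. *)
Lemma greedy_labelling (T : finType) (e : rel T) (b : T -> nat) :
  symmetric e -> (forall u v, e u v -> b u != b v) ->
  exists g : T -> nat, (forall u v, e u v -> g u != g v) /\
    forall v i, i < g v -> exists u, [/\ e v u, b u < b v & g u = i].
Proof.
move=> esym bP.
have step n : exists g : T -> nat,
    (forall u v, b u < n -> b v < n -> e u v -> g u != g v) /\
    forall v i, b v < n -> i < g v -> exists u, [/\ e v u, b u < b v & g u = i].
  elim: n => [|n [g [gP gD]]]; first by exists (fun _ => 0).
  (* A label above all those in use is free, so a least free label exists. *)
  have ex v : exists i, ~~ [exists u, [&& e v u, b u < b v & g u == i]].
    exists (\max_u g u).+1; apply/existsP => -[u /and3P[_ _ /eqP gu]].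
    by have := leq_bigmax (F := g) u; rewrite gu ltnn.
  have old u v : b v = n -> e v u -> b u <= n -> b u < n.
    by move=> <- /bP; rewrite eq_sym ltn_neqAle => ->.
  exists (fun v => if b v == n then ex_minn (ex v) else g v); split.
    have new u v : b u = n -> b v < n -> e u v -> ex_minn (ex u) != g v.
      move=> bu bv euv; case: ex_minnP => i /existsP ni _.
      apply/eqP => gi; apply: ni; exists v.
      by rewrite euv bu bv gi eqxx.
    move=> u v; rewrite !ltnS => bu bv euv.
    have [bun|bun] := eqVneq (b u) n; have [bvn|bvn] := eqVneq (b v) n.
    - by case/eqP: (bP _ _ euv); rewrite bun bvn.
    - by apply: new; rewrite // (old _ u).
    - by rewrite eq_sym; apply: new; rewrite 1?esym // (old _ v) // esym.
    - by apply: gP; rewrite // ltn_neqAle ?bun ?bvn.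
  move=> v i; rewrite ltnS leq_eqVlt; case: eqP => [bv _|_ /= bv] /=.
    case: ex_minnP => j _ jmin ij.
    have : [exists u, [&& e v u, b u < b v & g u == i]].
      by apply: contraTT ij => /jmin; rewrite -leqNgt.
    case/existsP => u /and3P[evu buv /eqP gu]; exists u; split=> //.
    by rewrite -bv ltn_eqF.
  move=> /(gD _ _ bv) [u [evu buv gu]]; exists u; split=> //.
  by rewrite ltn_eqF // (ltn_trans buv).
have [g [gP gD]] := step (\max_v b v).+1.
have lt v : b v < (\max_v b v).+1 by rewrite ltnS leq_bigmax.
by exists g; split=> [u v|v i]; [apply: gP|apply: gD].
Qed.

(** * Bipartiteness and odd closed walks *)

Section Bipartite.

Variables (T : finType) (r : rel T).
Hypothesis rsym : symmetric r.

Definition odd_closed_walk (s : seq T) := cycle r s /\ odd (size s).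

(** In the bipartite double cover [r2], a path joining the two lifts of a vertex projects to an odd
    closed walk. Otherwise the lifts lie in distinct components, which every edge swaps, so
    comparing the ranks of their roots gives two colours. *)
Lemma bipartite_or_odd_closed_walk :
  (exists c : T -> bool, forall u v, r u v -> c u != c v) \/
  exists s, odd_closed_walk s.
Proof.
pose r2 (p q : T * bool) := r p.1 q.1 && (p.2 != q.2).
have r2sym : connect_sym r2.
  by apply: sym_connect_sym => p q; rewrite /r2 rsym eq_sym.
have [/existsP[v vv]|] := boolP [exists v, connect r2 (v, true) (v, false)].
  right; have [p pp lp] := connectP vv.
  exists [seq q.1 | q <- p].
  have walk (q : T * bool) p' : path r2 q p' ->
      path r q.1 [seq q.1 | q <- p'] /\ (last q p').2 = q.2 (+) odd (size p').
    elim: p' q => [|q' p' IH] q /=; first by rewrite addbF.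
    case/andP => /andP[rq neq] /IH [-> ->]; rewrite rq; split=> //.
    by case: q.2 neq; case: q'.2; case: (odd _).
  have [pr] := walk _ _ pp; rewrite -lp /= => odd_p; split; last first.
    by rewrite size_map; case: (odd _) odd_p.
  have : last v [seq q.1 | q <- p] = v.
    by rewrite -[v in last v _]/((v, true).1) last_map -lp.
  case: (lastP [seq q.1 | q <- p]) pr => [|p' y] //= pr.
  by rewrite last_rcons => yv; rewrite -(rotr_cycle 1) rotr1_rcons /= yv in pr *.
rewrite negb_exists => /forallP nv; left.
exists (fun v => enum_rank (root r2 (v, true)) < enum_rank (root r2 (v, false))).
move=> u v ruv.
have eqr a : root r2 (u, a) = root r2 (v, ~~ a).
  by apply/(rootP r2sym)/connect1; rewrite /r2 /= ruv; case: a.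
rewrite !eqr /=.
have : enum_rank (root r2 (v, true)) != enum_rank (root r2 (v, false)) :> nat.
  rewrite (inj_eq val_inj) (inj_eq enum_rank_inj).
  by rewrite root_connect.
by case: ltngtP.
Qed.

End Bipartite.

(** * Label-decreasing paths and forced adjacencies *)

Section ColourfulPathsClose.

Variables (T : finType) (e : rel T) (j : nat) (b g : T -> nat).
Hypotheses (esym : symmetric e) (eirr : irreflexive e).
Hypothesis girth : forall s, graph_cycle e s -> j.+4 <= size s.
Hypothesis bP : forall u v, e u v -> b u != b v.
Hypothesis close : forall x p, path e x p -> size p = j.+3 ->
  uniq (map b (x :: p)) -> e x (last x p).
Hypothesis greedy :
  forall v i, i < g v -> exists u, [/\ e v u, b u < b v & g u = i].

(* The colours on p need only be distinct and below that of v, which makes p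
   freely concatenable with vertices of colour at least b v. *)
Definition descent (v : T) (i : nat) (p : seq T) :=
  [/\ path e v p, uniq (map b p), all (fun u => b u < b v) p,
      size p = i.+1 & g (head v p) = i /\ g (last v p) = 0].

Lemma descent_exists v i : i < g v -> exists p, descent v i p.
Proof.
elim: i v => [|i IH] v /greedy[u [evu buv gu]].
  by exists [:: u]; split; rewrite /= ?evu ?buv.
have [|p [pp up ap sp [_ lp]]] := IH u; first by rewrite gu.
have ap' x : x \in p -> b x < b u by move/(allP ap).
exists (u :: p); split=> /=; rewrite ?evu ?sp //.
- rewrite up andbT; apply/mapP => -[x /ap'] + bx.
  by rewrite bx ltnn.
- by rewrite buv; apply/allP => x /ap'/ltn_trans; apply.
Qed.

Lemma descent_above v i p c : descent v i p -> b v <= c -> c \notin map b p.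
Proof.
case=> _ _ ap _ _ vc; apply/mapP => -[x /(allP ap) + cx].
by rewrite -cx ltnNge vc.
Qed.

(** For positive [j] the girth is at least 5. *)
Lemma no_C4 x y z t : 0 < j -> e x y -> e y z -> e z t -> e t x ->
  x != z -> y != t -> False.
Proof.
move=> j0 xy yz zt tx xz yt.
have ne u v : e u v -> u != v by move/bP; apply: contraNneq => ->.
have := girth (s := [:: x; y; z; t]); rewrite /graph_cycle /= xy yz zt tx.
rewrite !inE !negb_or xz yt (ne _ _ xy) (ne _ _ yz) (ne _ _ zt).
by rewrite [x == t]eq_sym (ne _ _ tx) => /(_ (conj isT (conj isT isT))); lia.
Qed.

(** * Around a colour minimum of the walk *)

Section Core.

Variables m x v w n n2 : T.
Hypotheses (emx : e m x) (exv : e x v) (evw : e v w) (ewn : e w n)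
  (enn2 : e n n2).
Hypotheses (Nmw : ~~ e m w) (Nxn : ~~ e x n) (Nvn2 : ~~ e v n2)
  (Nmn2 : ~~ e m n2).
Hypotheses (gx : j < g x) (gv : j < g v) (gw : j < g w) (gn : j < g n).
Hypotheses (xm : b x <= b m) (xv : b x <= b v) (xw : b x <= b w)
  (xn : b x <= b n) (xn2 : b x <= b n2).

(* Among the candidate edges, m n2 is the one that needs k = 4; for k > 4 the
   4-cycle is x, last Y, n2, t, where t starts the descent from x. *)
Lemma minimum_recurs : b w = b x.
Proof.
apply/eqP; apply: contraT => bwx.
have bxv := bP exv; have bvw := bP evw; have bwn := bP ewn.
have bnn2 := bP enn2; have bmx := bP emx.
(* [X] and [N] have [j + 1] vertices each, so three more complete a path on [k] vertices. *)
have [X DX] := descent_exists gx; have [pX uX aX sX [hX lX]] := DX.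
have [N DN] := descent_exists gn; have [pN uN aN sN [hN lN]] := DN.
have Xc := descent_above DX.
have wX : e w (last x X).
  apply: (close (p := v :: x :: X)); rewrite /= ?sX //.
    by rewrite esym evw esym exv.
  rewrite !inE !negb_or !Xc // uX bwx eq_sym bvw.
  by rewrite eq_sym bxv.
(* On the path [x], [X], [w], [n] only [x] and [n] could share a colour, and they are not
   adjacent. *)
have bn : b n = b x.
  apply/eqP; apply: contraNT Nxn => bnx.
  have := close (x := x) (p := X ++ [:: w; n]).
  rewrite last_cat cat_path pX /= esym wX ewn size_cat sX addn2; apply=> //.
  rewrite map_cat; apply: (@uniq_cat_mid _ [:: b x]) => //=; last by rewrite !Xc.
  by rewrite !inE !negb_or bwn ![b x == _]eq_sym bwx bnx.
have Nc c : b x <= c -> c \notin map b N by rewrite -bn; exact: (descent_above DN).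
have vN : e v (last n N).
  apply: (close (p := w :: n :: N)); rewrite /= ?sN //.
    by rewrite evw ewn.
  by rewrite !inE !negb_or !Nc // uN bvw bwn bn [_ == b x]eq_sym bxv.
(* The non-edges [v n2] and [m w] force two more coincidences in the same way. *)
have bn2 : b n2 = b v.
  apply/eqP; apply: contraNT Nvn2 => bn2v; rewrite esym.
  have := close (x := n2) (p := n :: N ++ [:: v]).
  rewrite /= last_cat cat_path pN /= [e n2 n]esym enn2 [e _ v]esym vN.
  rewrite size_cat sN addn1; apply=> //.
  rewrite map_cat.
  apply: (@uniq_cat_mid _ [:: b n2; b n] _ [:: b v]) => //=; last by rewrite !Nc.
  by rewrite !inE !negb_or eq_sym bnn2 bn2v bn bxv.
have bm : b m = b w.
  apply/eqP; apply: contraNT Nmw => bmw.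
  have := close (x := m) (p := x :: X ++ [:: w]).
  rewrite /= last_cat cat_path pX /= emx esym wX size_cat sX addn1; apply=> //.
  rewrite map_cat.
  apply: (@uniq_cat_mid _ [:: b m; b x] _ [:: b w]) => //=; last by rewrite !Xc.
  by rewrite !inE !negb_or bmx bmw eq_sym bwx.
case: X DX pX uX aX sX hX lX Xc wX => // t X' DX pX uX _ sX /= hX _ Xc wX.
have /= /andP[ext pX'] := pX.
(* Starting at [t] leaves out [x], whose colour recurs at [n]. *)
have tn2 : e t n2.
  have := close (x := t) (p := X' ++ [:: w; n; n2]).
  rewrite last_cat cat_path pX' /= esym wX ewn enn2 size_cat /= addn3.
  case: sX => ->; apply=> //; rewrite map_cat.
  apply: (@uniq_cat_mid _ [::] (map b (t :: X'))) => //=; last by rewrite !Xc.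
  by rewrite !inE !negb_or bwn bn2 [b w == _]eq_sym bvw -bn2 bnn2.
have [j0|j0] := posnP j.
  have X0 : X' = [::] by apply: size0nil; move: sX; rewrite j0 => -[].
  case/negP: Nmn2; apply: (close (p := [:: x; t; n2])); rewrite /= ?j0 //.
    by rewrite emx ext tn2.
  have tl c : b x <= c -> c != b t by move/Xc; rewrite X0 inE.
  rewrite !inE !negb_or bmx bm bn2 [b w == b v]eq_sym bvw bxv.
  by rewrite [b t == _]eq_sym !tl.
have [y [ewy _ gy]] := greedy gw.
have [|Y DY] := @descent_exists y j.-1; first by rewrite gy ltn_predL.
have [pY uY _ sY [_ lY]] := DY; rewrite prednK // in sY.
(* Greediness only puts [b y] below [b w]. If [b y] were missing from the colours of [n :: N] or of
   [v :: N], a closing path would create a 4-cycle. As [b n] and [b v] differ, [b y] occurs on [N],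
   hence lies below [b n = b x]. *)
have by_lt : b y < b x.
  have byw := bP ewy.
  have yn : y != n by apply: contraTneq gn => <-; rewrite gy ltnn.
  have by_nN : b y \in b n :: map b N.
    apply: contraT => byN.
    have yN : e y (last n N).
      apply: (close (p := w :: n :: N)); rewrite /= ?sN //.
        by rewrite esym ewy ewn.
      move: byN; rewrite !inE !negb_or => /andP[-> ->].
      by rewrite eq_sym byw bwn uN !Nc.
    have wN : w != last n N.
      move: (Nc _ xw); apply: contraNneq => ->.
      by case: (N) sN => // a s _; rewrite map_f //= mem_last.
    case: (@no_C4 y w v (last n N) j0); rewrite // 1?esym //.
    by apply: contraTneq gv => <-; rewrite gy ltnn.
  have by_vN : b y \in b v :: map b N.
    apply: contraT => byN.
    case: N DN pN uN vN {aN lN by_nN} sN hN Nc byN => // tn N' DN pN uN /= vN sN hN Nc byN.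
    have /= /andP[entn pN'] := pN.
    have yN : e tn y.
      have := close (x := tn) (p := N' ++ [:: v; w; y]).
      rewrite last_cat cat_path pN' /= [e _ v]esym vN ewy evw size_cat addn3.
      case: sN => ->; apply=> //; rewrite map_cat.
      move: byN; rewrite inE negb_or => /andP[byv byN].
      apply: (@uniq_cat_mid _ [::] (map b (tn :: N'))) => //=; last first.
        by rewrite (Nc _ xv) (Nc _ xw) byN.
      by rewrite !inE !negb_or bvw byw [b v == _]eq_sym byv.
    case: (@no_C4 y w n tn j0); rewrite // 1?esym //.
    by have := Nc _ xw; rewrite inE negb_or; apply: contraTneq => ->; rewrite eqxx.
  move: by_nN by_vN; rewrite !inE bn; case/orP=> [/eqP->|byN _].
    by case/orP=> [|byN]; [rewrite (negbTE bxv)|have := Nc _ (leqnn _); rewrite byN].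
  by rewrite ltnNge; apply: contraL byN => /Nc.
have Yc c : b x <= c -> c \notin map b (y :: Y).
  move=> xc; rewrite inE negb_or (descent_above DY) ?andbT.
    by rewrite gtn_eqF // (leq_trans by_lt).
  exact: leq_trans (ltnW by_lt) xc.
have uyY : uniq (map b (y :: Y)) by rewrite /= uY (descent_above DY).
have n2Y : e n2 (last y Y).
  apply: (close (p := n :: w :: y :: Y)).
  - by rewrite /= [e n2 n]esym enn2 [e n w]esym ewn ewy.
  - by rewrite /= sY.
  rewrite !map_cons -map_cons -[map b (y :: Y)]cats0.
  apply: (@uniq_cat_mid _ [:: b n2; b n; b w] _ [::]) => //.
    by rewrite /= !inE !negb_or eq_sym bnn2 bn2 bvw eq_sym bwn.
  by rewrite /= -/(map b (y :: Y)) !Yc // bn.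
have xY : e x (last y Y).
  apply: (close (p := v :: w :: y :: Y)).
  - by rewrite /= exv evw ewy.
  - by rewrite /= sY.
  rewrite !map_cons -map_cons -[map b (y :: Y)]cats0.
  apply: (@uniq_cat_mid _ [:: b x; b v; b w] _ [::]) => //.
    by rewrite /= !inE !negb_or bxv eq_sym bwx bvw.
  by rewrite /= -/(map b (y :: Y)) !Yc.
(* [last y Y] has label 0 and [t] has label [j > 0], so they differ. *)
case: (@no_C4 x (last y Y) n2 t j0); rewrite // 1?esym //.
  by apply: contra_neq bxv => ->.
by apply: contraTneq j0 => yt; rewrite -hX -yt lY.
Qed.

End Core.



(** * Shortest odd closed walks among high labels *)

(** Restricting edges rather than vertices isolates the low labels and keeps colourings total on
    [T]. *)
Definition deep_edge (u v : T) := [&& e u v, j < g u & j < g v].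

Lemma deep_edge_sym : symmetric deep_edge.
Proof. by move=> u v; rewrite /deep_edge esym [(j < g u) && _]andbC. Qed.

(** Each edge excluded in [minimum_recurs] would bypass two or four vertices of the walk and leave a
    shorter odd closed walk. *)
Lemma minimum_two_steps_on (s : seq T) :
  (forall s', size s' < size s -> ~ odd_closed_walk deep_edge s') ->
  odd_closed_walk deep_edge s ->
  forall x0, (forall u, u \in s -> b (head x0 s) <= b u) ->
  b (nth x0 s 2) = b (head x0 s).
Proof.
case: s => [|x [|v [|w [|n [|n2 s]]]]] shortest [cs os] x0 xmin; rewrite //=.
(* Length 1 would give a loop, length 3 a triangle. *)
- by move: cs; rewrite /= /deep_edge eirr.
- move: cs => /= /and4P[/and3P[xv _ _] /and3P[vw _ _] /and3P[wx _ _] _].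
  have ne u u' : e u u' -> u != u' by move/bP; apply: contraNneq => ->.
  have := girth (s := [:: x; v; w]); rewrite /graph_cycle /= xv vw wx.
  rewrite !inE !negb_or (ne _ _ xv) (ne _ _ vw) [x == w]eq_sym (ne _ _ wx).
  by move=> /(_ (conj isT (conj isT isT))).
move: cs; rewrite /= rcons_path => /and5P[xv vw wn nn2 /andP[p2 mx]].
(* In length 5, [m] and [n2] coincide, which [minimum_recurs] allows. *)
set m := last n2 s in mx *.
have cyc u q : path deep_edge u q -> deep_edge (last u q) u ->
    cycle deep_edge (u :: q).
  by move=> pq lq; rewrite /= rcons_path pq.
have [/and3P[exv gx gv] /and3P[evw _ gw]] := (xv, vw).
have [/and3P[ewn _ gn] /and3P[enn2 _ gn2]] := (wn, nn2).
have /and3P[emx gm _] := mx.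
have minx u : u \in [:: x, v, w, n, n2 & s] -> b x <= b u by apply: xmin.
apply: (@minimum_recurs m x v w n n2) => //; last 5 first.
- by apply: minx; rewrite !inE -in_cons mem_last !orbT.
- by apply: minx; rewrite !inE eqxx ?orbT.
- by apply: minx; rewrite !inE eqxx ?orbT.
- by apply: minx; rewrite !inE eqxx ?orbT.
- by apply: minx; rewrite !inE eqxx ?orbT.
- apply/negP => mw; apply: (shortest [:: w, n, n2 & s]) => //; split.
    by apply: cyc; rewrite /= ?wn ?nn2 // /deep_edge -/m mw gm.
  by move: os => /=; rewrite !negbK.
- apply/negP => xn; apply: (shortest [:: x, n, n2 & s]) => //; split.
    by apply: cyc; rewrite /= ?nn2 // /deep_edge xn gx gn.
  by move: os => /=; rewrite !negbK.
- apply/negP => vn2; apply: (shortest [:: x, v, n2 & s]) => //; split.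
    by apply: cyc; rewrite /= ?xv // /deep_edge vn2 gv gn2.
  by move: os => /=; rewrite !negbK.
- apply/negP => mn2; apply: (shortest (n2 :: s)); first by move=> /=; lia.
  split.
    by apply: cyc; rewrite //= /deep_edge -/m mn2 gm.
  by move: os => /=; rewrite !negbK.
Qed.

(** A shortest such walk, rotated to start at a colour minimum, has that colour at every even index.
    Its last index is even, yet the last vertex is adjacent to the head. *)
Lemma no_odd_closed_walk (s : seq T) : ~ odd_closed_walk deep_edge s.
Proof.
have [N] := ubnP (size s); elim: N s => // N IH s; rewrite ltnS => sN walk.
have {IH} shortest s' : size s' < size s -> ~ odd_closed_walk deep_edge s'.
  by move=> lt; apply: IH; apply: leq_trans sN.
have [y ys] : exists y, y \in s.
  by case: (s) walk => [[]|y s' _] //; exists y; rewrite mem_head.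
have [x xs xmin] := arg_minnP b ys.
have [i s1 Es] := rot_to xs.
have rot_walk l : odd_closed_walk deep_edge (rot l (x :: s1)).
  by rewrite -Es /odd_closed_walk !size_rot !rot_cycle.
have sizes : size s = (size s1).+1 by rewrite -(size_rot i) Es.
have smin u : u \in x :: s1 -> b x <= b u by rewrite -Es mem_rot; apply: xmin.
have head_rot l d : l + d < (size s1).+1 ->
    nth x (rot l (x :: s1)) d = nth x (x :: s1) (l + d).
  by move=> ld; rewrite /rot nth_cat size_drop /= ltn_subRL ld nth_drop.
have even_min l : l.*2 < (size s1).+1 -> b (nth x (x :: s1) l.*2) = b x.
  elim: l => // l IH; rewrite doubleS => l2.
  have bl : b (nth x (x :: s1) l.*2) = b x by apply: IH; lia.
  (* This rotation again has a vertex of minimum colour at its head. *)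
  have := @minimum_two_steps_on (rot l.*2 (x :: s1)).
  rewrite size_rot /= -sizes => /(_ shortest (rot_walk _) x).
  rewrite -nth0 !head_rot ?addn2 ?addn0 ?bl //; last by lia.
  by apply=> u; rewrite mem_rot; apply: smin.
have [cs os] := rot_walk 0; rewrite rot0 /= in cs os.
have := even_min (size s1)./2.
rewrite halfK (negbTE os) subn0 -[X in nth _ _ X]/((size (x :: s1)).-1) nth_last /=.
move=> /(_ (ltnSn _)) /eqP; apply/negP/bP.
by move: cs; rewrite rcons_path => /andP[_ /and3P[]].
Qed.

(** Labels [0] to [j] serve as colours, and the bipartite rest takes two more: [j + 3 = k - 1] in
    all. *)
Lemma colourable_pred : (forall u v, e u v -> g u != g v) -> colourable e j.+3.
Proof.
move=> gP; have [[c cP]|[s /no_odd_closed_walk//]] :=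
  bipartite_or_odd_closed_walk deep_edge_sym.
pose f v := if g v <= j then g v else j.+1 + c v.
have fj v : f v < j.+3.
  rewrite /f; case: (leqP (g v) j) => [gv|_]; first by lia.
  by have := leq_b1 (c v); lia.
exists (fun v => Ordinal (fj v)) => u v euv [] fuv.
have := gP u v euv; have := cP u v; rewrite /deep_edge euv /=.
move: fuv; rewrite /f; case: (leqP (g u) j) => gu; case: (leqP (g v) j) => gv.
- by move=> -> _; rewrite eqxx.
- by move=> guv; exfalso; lia.
- by move=> guv; exfalso; lia.
- by move=> /addnI cuv /(_ isT); case: (c u) (c v) cuv => [] [].
Qed.

End ColourfulPathsClose.

(** * Girth and chords of a path *)

Section Induced.

Variables (T : finType) (e : rel T) (k : nat).
Hypotheses (esym : symmetric e) (eirr : irreflexive e).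
Hypothesis girth : forall s, graph_cycle e s -> k <= size s.

Lemma sorted_cycle x0 (s : seq T) :
  sorted e s -> e (last x0 s) (head x0 s) -> cycle e s.
Proof. by case: s => //= x s ps; rewrite rcons_path ps. Qed.

(** A chord between positions [i < i'] closes a cycle on [i' - i + 1] vertices, so the girth leaves
    only the two ends as a candidate. *)
Lemma path_induced x p : path e x p -> uniq (x :: p) -> size (x :: p) = k ->
  ~~ e x (last x p) -> induced_path e (x :: p).
Proof.
move=> pxp uxp sxp Nxl; split=> // x0.
have wlg i i' : i < i' -> i' < size (x :: p) ->
    e (nth x0 (x :: p) i) (nth x0 (x :: p) i') = (i.+1 == i').
  move=> ii' i'p; have [i'E|ne] := eqVneq i.+1 i'.
    move: i'p; rewrite -i'E.
    by have /(sortedP x0) adj : sorted e (x :: p) := pxp; apply: adj.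
  apply: contraNF Nxl => eii'.
  pose s := drop i (take i'.+1 (x :: p)).
  have s_size : size s = i'.+1 - i by rewrite size_drop size_takel.
  have /girth : graph_cycle e s.
    split; first by rewrite s_size; lia.
    split; first by rewrite drop_uniq // take_uniq.
    apply: (@sorted_cycle x0); first by rewrite drop_sorted // take_sorted.
    rewrite -nth_last s_size -nth0 !nth_drop !nth_take; try lia.
    by rewrite esym addn0 (_ : i + _ = i') //; lia.
  rewrite s_size -sxp => le; move: eii'.
  have -> : i' = (size (x :: p)).-1 by lia.
  have -> : i = 0 by lia.
  by rewrite nth_last.
move=> i i' ip i'p; case: (ltngtP i i') => [lt|lt|->].
- by rewrite wlg // [i'.+1 == i](_ : _ = false) ?orbF //; lia.
- by rewrite esym wlg // [i.+1 == i'](_ : _ = false) //; lia.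
- by rewrite eirr; lia.
Qed.

End Induced.

Theorem theorem2 (k : nat) (T : finType) (e : rel T) :
  4 <= k ->
  simple_graph e ->
  is_girth e k ->
  is_chromatic_number e k ->
  forall (t : nat) (beta : T -> 'I_t),
    0 < t ->
    proper_colouring e beta ->
    exists p : seq T,
      size p = k /\ induced_path e p /\ colourful beta p.
Proof.
case: k => [|[|[|[|j]]]] // _ [esym eirr] [_ girth] [_ chrom] t beta _ betaP.
(* A boolean test on tuples makes the existence of such a path decidable. *)
pose open_path (s : seq T) := if s is x :: p then
  [&& path e x p, uniq (map beta s) & ~~ e x (last x p)] else false.
have [/existsP[p]|] := boolP [exists p : j.+4.-tuple T, open_path p].
  case: p => p sp /=; case: p sp => // x p sp /and3P[pxp uxp Nxl].
  exists (x :: p); split; first exact/eqP.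
  split=> //; apply: (path_induced esym eirr girth) => //; last exact/eqP.
  exact: (map_uniq uxp).
move/existsPn => none.
pose b v : nat := beta v.
have bP u v : e u v -> b u != b v by move/betaP/eqP.
have close x p : path e x p -> size p = j.+3 -> uniq (map b (x :: p)) ->
    e x (last x p).
  move=> pxp sp uxp; have sxp : size (x :: p) == j.+4 by rewrite /= sp.
  have uxp' : uniq (map beta (x :: p)).
    by rewrite -(map_inj_uniq val_inj) -map_comp.
  by apply: contraNT (none (Tuple sxp)) => Nxl; apply/and3P; split.
have [g [gP gD]] := greedy_labelling esym bP.
have := chrom _ (colourable_pred esym eirr girth bP close gD gP).
by rewrite ltnn.
Qed.
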